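(* Let $p\in(0,1)$ and let $A\subset\mathbb{N}$ be the Bernoulli random subset in which each $n\in\mathbb{N}$ is independently included in $A$ with probability $p$. Then with probability $1$ there exist natural numbers $x,y\in\mathbb{N}$ such that \[ \{x,\;y,\;x+y,\;x\cdot y\}\subset A . \]
   Context: $\mathbb{N}=\{1,2,3,\dots\}$. *)

(* Defs.v *)
From HB Require Import structures.
From mathcomp Require Import all_boot all_order all_algebra finmap.
From mathcomp Require Import all_classical all_reals all_analysis.

Set Implicit Arguments.
Unset Strict Implicit.
Unset Printing Implicit Defensive.
Import Order.TTheory GRing.Theory Num.Theory.
Local Open Scope classical_set_scope.
Local Open Scope ereal_scope.

Definition mutually_independent_events {d : measure_display}
    {T : measurableType d} {R : realType} (P : probability T R)
    {I : choiceType} (D : set I) (E : I -> set T) : Prop :=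
  forall J : {fset I}, [set` J] `<=` D ->
    P (\bigcap_(i in [set` J]) E i) = \prod_(i <- J) P (E i).

(* The natural numbers of the source are {1, 2, 3, ...}; they are represented
   inside the type [nat] by the set of positive elements. *)
Definition posnat : set nat := [set n | (0 < n)%N].

(* [A w] is the value of the random set A at the outcome w. *)
Definition bernoulli_random_subset {d : measure_display}
    {T : measurableType d} {R : realType} (P : probability T R)
    (p : R) (A : T -> set nat) : Prop :=
  [/\ forall w, A w `<=` posnat,
      forall n, posnat n -> measurable [set w | A w n],
      forall n, posnat n -> P [set w | A w n] = p%:E
    & mutually_independent_events P posnat (fun n => [set w | A w n])].

(* Main.v *)
Require Import Defs.
From HB Require Import structures.
From mathcomp Require Import all_boot all_order all_algebra finmap.
From mathcomp Require Import all_classical all_reals all_analysis.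
From mathcomp Require Import zify.

(* Setting x = a and y = a + 1 for a rapidly growing sequence of a's gives
   infinitely many pairwise disjoint quadruples {x, y, x + y, x y}. By
   independence A misses each of the first n of them with probability
   (1 - p^4)^n, which tends to 0. *)

Import Order.TTheory GRing.Theory Num.Theory.
Local Open Scope classical_set_scope.
Local Open Scope ring_scope.

Section bernoulli_blocks.
Variables (R : realType) (p : R) (d : measure_display) (T : measurableType d).
Variables (P : probability T R) (A : T -> set nat).
Hypotheses (hp0 : 0 < p) (hp1 : p < 1) (hA : bernoulli_random_subset P p A).

Let contains (J : {fset nat}) : set T :=
  \bigcap_(i in [set` J]) [set w | A w i].

Lemma measurable_contains (J : {fset nat}) :
  [set` J] `<=` posnat -> measurable (contains J).
Proof.
case: hA => _ mA _ _ Jpos.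
by apply: fin_bigcap_measurable => [|i /Jpos]; [exact: finite_fset|exact: mA].
Qed.

Lemma probability_contains (J : {fset nat}) :
  [set` J] `<=` posnat -> P (contains J) = (p ^+ #|` J|)%:E.
Proof.
case: hA => _ _ pA indA Jpos; rewrite indA//.
rewrite (eq_big_seq (fun=> p%:E)); last by move=> i iJ; rewrite pA//; exact: Jpos.
by rewrite prodEFin big_const_seq count_predT iter_mulr_1.
Qed.

Variables (c : nat) (S : nat -> {fset nat}).
Hypotheses (Spos : forall k, [set` S k] `<=` posnat)
  (Scard : forall k, #|` S k| = c)
  (Sdisj : forall j k, (j < k)%N -> [disjoint S j & S k]%fset).

(* The extra set J is what makes the induction on n go through: removing the
   n-th block event turns J into its union with S n. *)
Lemma probability_contains_setD (n : nat) (J : {fset nat}) :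
  [set` J] `<=` posnat ->
  (forall k, (k < n)%N -> [disjoint S k & J]%fset) ->
  P (contains J `\` \bigcup_(k < n) contains (S k)) =
    (p ^+ #|` J| * (1 - p ^+ c) ^+ n)%:E.
Proof.
elim: n J => [|n IHn] J Jpos SJ.
  by rewrite II0 bigcup_set0 setD0 probability_contains// expr0 mulr1.
have mU : measurable (\bigcup_(k < n) contains (S k)).
  by apply: bigcup_measurable => k _; exact: measurable_contains.
have mJ := measurable_contains _ Jpos.
have SJn k : (k < n)%N -> [disjoint S k & J]%fset by move=> /ltnW; exact: SJ.
have JSpos : [set` (J `|` S n)%fset] `<=` posnat.
  by rewrite set_fsetU => i [/Jpos|/Spos].
(* The [n]-th block event is removed last, by P(X \ Y) = P(X) - P(X & Y). Intersecting X with that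
   event only enlarges the prescribed set [J] to [J] united with [S n], so the induction hypothesis
   covers both terms. *)
rewrite IIS bigcup_setU bigcup_set1 -setDDl measureD; last first.
- by rewrite (le_lt_trans (probability_le1 _ _)) ?ltry//; exact: measurableD.
- exact: measurable_contains.
- exact: measurableD.
rewrite setIDAC setIDA.
have -> : contains J `&` contains (S n) = contains (J `|` S n)%fset.
  by rewrite /contains set_fsetU bigcap_setU.
rewrite [X in (X - _)%E](IHn _ Jpos SJn).
rewrite [X in (_ - X)%E](IHn _ JSpos) //; last first.
  by move=> k kn; rewrite fdisjointXU SJn//= Sdisj.
rewrite cardfsU (_ : (J `&` S n)%fset = fset0); last first.
  by apply/eqP; rewrite fsetIC; exact: SJ.
rewrite cardfs0 subn0 Scard -EFinB exprD exprS; congr EFin.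
by rewrite mulrBl mul1r mulrBr -!mulrA.
Qed.

(** For every n the probability is at least [1 - (1 - p ^+ c) ^+ n], the probability that one of the
    first n blocks is contained; n then tends to infinity. *)
Lemma probability_contains_some_block :
  P (\bigcup_k contains (S k)) = 1%E.
Proof.
have mS k : measurable (contains (S k)) by exact: measurable_contains.
have mU n : measurable (\bigcup_(k < n) contains (S k)).
  by apply: bigcup_measurable.
have mUT : measurable (\bigcup_k contains (S k)) by exact: bigcup_measurable.
apply/eqP; rewrite eq_le probability_le1//=.
have q0 : 0 < p ^+ c by rewrite exprn_gt0.
have q1 : p ^+ c <= 1 by rewrite exprn_ile1// ltW.
have lb n : ((1 - (1 - p ^+ c) ^+ n)%:E <= P (\bigcup_k contains (S k)))%E.
  apply: (@le_trans _ _ (P (\bigcup_(k < n) contains (S k)))).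
    (* For empty [J] the event [contains J] is the whole space, so the lemma gives the probability
       of the complement of the union. *)
    have := @probability_contains_setD n fset0.
    rewrite {1}/contains set_fset0 bigcap_set0 setTD cardfs0 expr0 mul1r => PC.
    rewrite -[in leRHS](setCK (\bigcup_(k < n) contains (S k))).
    rewrite probability_setC; last exact/measurableC/mU.
    by rewrite PC// => k _; exact: fdisjointX0.
  by apply: le_measure; rewrite ?inE//; exact: bigcup_subset.
rewrite -[leRHS]fineK ?fin_num_measure// lee_fin.
have : (fun n => 1 - (1 - p ^+ c) ^+ n) @ \oo --> 1 - (0 : R).
  apply: cvgB; first exact: cvg_cst.
  by apply: cvg_expr; rewrite ger0_norm ?subr_ge0// gtrBl.
rewrite subr0 => /cvgr_to_le; apply; apply: nearW => n.
by rewrite -lee_fin fineK ?fin_num_measure.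
Qed.
End bernoulli_blocks.

(** Each start is one more than a(a+1), the largest element of the previous block. The first start
    is 2 because a = 1 would give a(a+1) = a+1, a repeated element. *)
Fixpoint block_start (k : nat) : nat :=
  if k is j.+1 then (block_start j * (block_start j).+1).+1 else 2.

Definition block (k : nat) : {fset nat} :=
  let a := block_start k in
  [fset i in [:: a; a.+1; (a + a.+1)%N; (a * a.+1)%N]]%fset.

Lemma block_start_ge2 (k : nat) : (2 <= block_start k)%N.
Proof. by elim: k => //= k; nia. Qed.

(** Since a >= 2, the product a(a+1) is the largest of the four elements. The blocks thus sit in
    consecutive intervals, whence their disjointness. *)
Lemma mem_block (k i : nat) : i \in block k ->
  (block_start k <= i < block_start k.+1)%N.
Proof.
have := block_start_ge2 k; rewrite !inE /= orbF => a2.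
by move=> /or4P[] /eqP ->; nia.
Qed.

Lemma block_posnat (k : nat) : [set` block k] `<=` posnat.
Proof.
by move=> i /mem_block /andP[+ _]; have := block_start_ge2 k; rewrite /posnat/=; lia.
Qed.

(** For a >= 2 one has a < a+1 < 2a+1 < a(a+1). *)
Lemma card_block (k : nat) : #|` block k| = 4.
Proof.
have := block_start_ge2 k; rewrite /block; move: (block_start k) => a a2.
rewrite card_fseq undup_id//= !inE; nia.
Qed.

Lemma block_disjoint (j k : nat) :
  (j < k)%N -> [disjoint block j & block k]%fset.
Proof.
move=> jk; apply/fdisjointP => i /mem_block /andP[_ ij]; apply/negP.
move=> /mem_block /andP[ik _]; have : (block_start j.+1 <= block_start k)%N.
  apply: (homo_leq leqnn leq_trans) jk => n /=.
  by have := block_start_ge2 n; nia.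
by rewrite leqNgt (leq_ltn_trans ik ij).
Qed.

Theorem theorem5 (R : realType) (p : R) (hp0 : 0 < p) (hp1 : p < 1)
    (d : measure_display) (T : measurableType d) (P : probability T R)
    (A : T -> set nat) (hA : bernoulli_random_subset P p A) :
  P [set w | exists x y : nat, [/\ posnat x, posnat y &
       [set x; y; (x + y)%N; (x * y)%N] `<=` A w]] = 1%E.
Proof.
set E := [set w | _]; apply/eqP; rewrite eq_le.
have mE : measurable E.
  (* Measurability: [E] is a countable union of finite intersections of the events that a given
     positive number lies in [A]. *)
  have -> : E = \bigcup_(x in posnat) \bigcup_(y in posnat)
      \bigcap_(i in [set x; y; (x + y)%N; (x * y)%N]) [set w | A w i].
    apply/seteqP; split=> [w [x [y [x0 y0 sA]]]|w [x x0 [y y0 sA]]].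
      by exists x => //; exists y.
    by exists x, y.
  case: hA => _ mA _ _.
  apply: bigcup_measurable => x x0; apply: bigcup_measurable => y y0.
  apply: fin_bigcap_measurable => [|i]; first exact: finite_set4.
  by move=> [[[]|]|] ->; apply: mA; move: x0 y0; rewrite /posnat/=; nia.
rewrite probability_le1//=.
have pblock := probability_contains_some_block _ _ _ _ _ _ hp0 hp1 hA _ _ block_posnat
  card_block block_disjoint.
(* It remains to see that [E] includes the almost sure event that [A] contains some block; the block
   starting at a provides x = a and y = a+1. *)
rewrite -[leLHS]pblock; apply: le_measure; rewrite ?inE//.
  apply: bigcup_measurable => k _.
  exact: (measurable_contains _ _ _ _ _ _ hA _ (block_posnat k)).
move=> w [k _ kA]; exists (block_start k), (block_start k).+1.
split; rewrite /posnat/=; first by have := block_start_ge2 k; lia.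
  by [].
by move=> i [[[]|]|] ->; apply: kA; rewrite /= !inE eqxx ?orbT.
Qed.
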